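(* Let $R$ be a commutative semilocal ring with $2\in R^\times$, let $A$ be an Azumaya $R$-algebra and let $\sigma:A\to A$ be an orthogonal involution. Then the natural map \[\mathrm{SO}(A,\sigma)\to \prod_{\mathfrak m\in \mathrm{Max}\,R}\mathrm{SO}(A(\mathfrak m),\sigma(\mathfrak m))\] is surjective.
   Context: An $R$-algebra $A$ is Azumaya if it is a finitely generated projective $R$-module and $A(\mathfrak m):=A\otimes_R R/\mathfrak m$ is a central simple $R/\mathfrak m$-algebra for every maximal ideal $\mathfrak m$ of $R$ ($\mathrm{Max}\,R$ is the finite set of maximal ideals). An $R$-linear involution $\sigma$ of $A$ is orthogonal if for every maximal ideal $\mathfrak m$ the induced involution $\sigma(\mathfrak m)=\sigma\otimes_R\mathrm{id}_{R/\mathfrak m}$ of $A(\mathfrak m)$ is orthogonal. For an Azumaya algebra $B$ over a commutative ring $S$ with involution $\tau$, $\mathrm{O}(B,\tau)=\{u\in B: u^\tau u=1\}$ and $\mathrm{SO}(B,\tau)=\{u\in \mathrm{O}(B,\tau): \mathrm{Nrd}_{B/S}(u)=1\}$, where $\mathrm{Nrd}$ is the reduced norm. The map is induced by the reductions $A\to A(\mathfrak m)$. *)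

(* Defs.v *)
From HB Require Import structures.
From mathcomp Require Import all_boot all_order all_algebra.

Set Implicit Arguments.
Unset Strict Implicit.
Unset Printing Implicit Defensive.

Import GRing.Theory.
Local Open Scope ring_scope.

Definition is_ideal (R : comNzRingType) (m : R -> Prop) : Prop :=
  [/\ m 0, (forall x y, m x -> m y -> m (x + y)) &
      (forall r x, m x -> m (r * x))].

Definition maximal_ideal (R : comNzRingType) (m : R -> Prop) : Prop :=
  [/\ is_ideal m, ~ m 1 &
      forall J : R -> Prop, is_ideal J -> (forall x, m x -> J x) ->
        (forall x, J x -> m x) \/ J 1].

Definition is_twosided_ideal (B : nzRingType) (I : B -> Prop) : Prop :=
  [/\ I 0, (forall x y, I x -> I y -> I (x + y)) &
      (forall a x, I x -> I (a * x) /\ I (x * a))].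

Definition dual_basis (R : comNzRingType) (A : lmodType R) (k : nat)
    (e : 'I_k -> A) (f : 'I_k -> A -> R) : Prop :=
  (forall j r a b, f j (r *: a + b) = r * f j a + f j b) /\
  (forall a, a = \sum_(j < k) f j a *: e j).

Definition fg_projective (R : comNzRingType) (A : lmodType R) : Prop :=
  exists k (e : 'I_k -> A) (f : 'I_k -> A -> R), dual_basis e f.

(* Splittings.  Given a ring morphism phi : R -> S (S commutative),    *)
(* psi : A -> M_{n+1}(S) is a splitting if it is an R-algebra morphism *)
(* (over phi) whose S-linear extension  S (x)_R A -> M_{n+1}(S)  is    *)
(* bijective.  Bijectivity is expressed via a dual basis (e, f) of A:  *)
(* S (x)_R A is the retract of S^k given by t |-> sum t_j (x) e_j, so  *)
(* bijectivity means: t |-> sum_j t_j psi(e_j) is onto, and its kernel *)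
(* is contained in the kernel of t |-> (sum_j t_j phi(f_l(e_j)))_l.     *)

Definition splitting (R : comNzRingType) (A : algType R) (S : comNzRingType)
    (phi : {rmorphism R -> S}) (n : nat) (psi : A -> 'M[S]_n.+1) : Prop :=
  [/\ psi 1 = 1,
      (forall a b, psi (a + b) = psi a + psi b),
      (forall a b, psi (a * b) = psi a * psi b),
      (forall r a, psi (r *: a) = phi r *: psi a) &
      exists k (e : 'I_k -> A) (f : 'I_k -> A -> R),
        [/\ dual_basis e f,
            (forall M : 'M[S]_n.+1,
               exists t : 'I_k -> S, M = \sum_(j < k) t j *: psi (e j)) &
            (forall t : 'I_k -> S, \sum_(j < k) t j *: psi (e j) = 0 ->
               forall l : 'I_k, \sum_(j < k) t j * phi (f l (e j)) = 0)]].

(* Nrd_{A/R}(u) = 1 : the reduced norm is defined by splitting; it is  *)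
(* 1 iff det(psi u) = 1 for every splitting psi over every R-algebra.   *)
Definition nrd_eq1 (R : comNzRingType) (A : algType R) (u : A) : Prop :=
  forall (S : comNzRingType) (phi : {rmorphism R -> S}) (n : nat)
         (psi : A -> 'M[S]_n.+1),
    splitting phi psi -> \det (psi u) = 1.

Definition involution (R : comNzRingType) (A : algType R) (s : A -> A) : Prop :=
  [/\ (forall a b, s (a + b) = s a + s b),
      (forall r a, s (r *: a) = r *: s a),
      (forall a b, s (a * b) = s b * s a) &
      (forall a, s (s a) = a)].

Definition in_SO (R : comNzRingType) (A : algType R) (s : A -> A) (u : A) : Prop :=
  s u * u = 1 /\ nrd_eq1 u.

Definition central_simple (k : fieldType) (B : algType k) : Prop :=
  [/\ (1 : B) != 0,
      (exists n (e : 'I_n -> B), forall b, exists c : 'I_n -> k,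
          b = \sum_(j < n) c j *: e j),
      (forall z : B, (forall b, z * b = b * z) -> exists c : k, z = c%:A) &
      (forall I : B -> Prop, is_twosided_ideal I ->
          (forall x, I x -> x = 0) \/ I 1)].

(* An involution of a central simple algebra is orthogonal if, after  *)
(* extension to a splitting field L, it becomes the adjoint involution *)
(* of a symmetric nondegenerate bilinear form (Gram matrix g):         *)
(*   psi(s b) = g^-1 psi(b)^T g.                                        *)
Definition orthogonal_field (k : fieldType) (B : algType k) (s : B -> B) : Prop :=
  exists (L : fieldType) (phi : {rmorphism k -> L}) (n : nat)
         (psi : B -> 'M[L]_n.+1) (g : 'M[L]_n.+1),
    [/\ splitting phi psi, g^T = g, g \in unitmx &
        forall b, psi (s b) = invmx g *m (psi b)^T *m g].

(* q : A -> B realizes B = A (x)_R R/m = A/mA, where m = ker pi and    *)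
(* pi : R -> k is onto the field k (so k = R/m).                         *)
Definition reduction (R : comNzRingType) (A : algType R) (k : fieldType)
    (pi : {rmorphism R -> k}) (B : algType k) (q : A -> B) : Prop :=
  [/\ (forall c : k, exists r, pi r = c),
      (forall b : B, exists a, q a = b),
      [/\ q 1 = 1, (forall a b, q (a + b) = q a + q b),
          (forall a b, q (a * b) = q a * q b) &
          (forall r a, q (r *: a) = pi r *: q a)] &
      (forall a, q a = 0 <->
         exists s : seq (R * A), (forall p, p \in s -> pi p.1 = 0) /\
                                 a = \sum_(p <- s) p.1 *: p.2)].

(* Main.v *)
Require Import Defs.
From HB Require Import structures.
From mathcomp Require Import all_boot all_order all_algebra.
From mathcomp Require boolp classical_sets.
Import GRing.Theory.
Local Open Scope ring_scope.

(* Over a residue field, u in SO(B, tau) is written as u = y c^-1 tau(y) - 1 with y = 1 + u and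
   c + tau(c) = tau(y) y, namely c = tau(y) + p for a skew p in tau(f) B f of the same rank as the
   idempotent f, where f B = {b | y b = 0}.  The isometry y c^-1 sigma(y) - 1 makes sense for all
   y and all units c with c + sigma(c) = sigma(y) y; such data lift from the residue algebras
   since 2 is a unit, and its reduced norm is always 1 because det (1 - X Y) = det (1 - Y X) and
   sigma preserves reduced norms.
   The element p exists over any field: a skew p of submaximal rank can be enlarged unless every
   element of tau(f') B f' is symmetric for a complementary idempotent f' of f, which forces f' to
   have reduced rank 1.  That is excluded by parity: skew elements have even reduced rank, and so
   does f because det w = (-1)^(rank (1 - w)) for every isometry w, in particular for w = -u. *)

Set Implicit Arguments.
Unset Strict Implicit.

(** * Determinants and ranks of matrices *)

Lemma det_1subMC (S : comNzRingType) m n (X : 'M[S]_(m, n)) (Y : 'M_(n, m)) :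
  \det (1%:M - X *m Y) = \det (1%:M - Y *m X).
Proof.
(* The two Schur complements of [Z] give two block triangular factorisations, and hence two values
   of its determinant. *)
pose Z := block_mx 1%:M X Y 1%:M.
have E1 : Z = block_mx 1%:M 0 Y 1%:M *m block_mx 1%:M X 0 (1%:M - Y *m X).
  by rewrite mulmx_block !mul1mx !mulmx1 !mul0mx ?mulmx0 !addr0 subrKC.
have E2 : Z = block_mx 1%:M X 0 1%:M *m block_mx (1%:M - X *m Y) 0 Y 1%:M.
  by rewrite mulmx_block !mul1mx !mulmx1 !mul0mx ?mulmx0 !add0r subrK.
have := congr1 determinant E2; rewrite {1}E1 !det_mulmx !det_lblock !det_ublock.
by rewrite !det1 !mul1r !mulr1.
Qed.

Lemma rank_factorization (F : fieldType) m n (X : 'M[F]_(m, n)) :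
  exists P : 'M_(m, \rank X), exists Q : 'M_(\rank X, n),
  exists P' : 'M_(\rank X, m), exists Q' : 'M_(n, \rank X),
  [/\ X = P *m Q, P' *m P = 1%:M & Q *m Q' = 1%:M].
Proof.
have /row_fullP[P' PK] := col_base_full X; have /row_freeP[Q' QK] := row_base_free X.
by exists (col_base X), (row_base X), P', Q'; rewrite mulmx_base.
Qed.

Section FieldMatrices.
Variable F : fieldType.

Lemma signr_parity : (2%:R : F) != 0 -> forall a b : nat,
  (-1) ^+ a = (-1) ^+ b :> F -> odd a = odd b.
Proof.
move=> two0 a b; rewrite -(signr_odd _ a) -(signr_odd _ b).
have neq : (-1 : F) <> 1.
  by move=> E; case/eqP: two0; rewrite mulr2n -[X in X + _]opprK E addNr.
by case: (odd a); case: (odd b) => //=; rewrite ?expr1 ?expr0 => E; case: neq.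
Qed.

(** For a rank factorisation X = P Q, skewness of X gives P = Q^T C with C skew and invertible of
    size r = rank X. Then det C = (-1)^r det C, so r is even. *)
Lemma rank_alternating_even n (X : 'M[F]_n) :
  (2%:R : F) != 0 -> X^T = - X -> ~~ odd (\rank X).
Proof.
move=> two0 skewX; have [P [Q [P' [Q' [defX PK QK]]]]] := rank_factorization X.
have E : Q^T *m P^T = - (P *m Q) by rewrite -trmx_mul -defX.
pose C := - (P^T *m Q').
have defP : P = Q^T *m C.
  by rewrite /C mulmxN mulmxA E mulNmx opprK -mulmxA QK mulmx1.
have QtK : Q'^T *m Q^T = 1%:M by rewrite -trmx_mul QK trmx1.
have uC : C \in unitmx.
  suff /mulmx1_unit[] : (P' *m Q^T) *m C = 1%:M by [].
  by rewrite -mulmxA -defP.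
have CT : C^T = - C.
  have : Q^T *m C^T *m Q = - (Q^T *m C *m Q).
    by rewrite -defP -E defP !trmx_mul trmxK mulmxA.
  move/(congr1 (fun Y => Q'^T *m Y *m Q')).
  by rewrite mulmxN mulNmx !mulmxA QtK !mul1mx -!mulmxA QK !mulmx1.
have := congr1 determinant CT; rewrite det_tr -scaleN1r detZ => /eqP.
rewrite -{1}[\det C]mul1r => /eqP /(mulIr (_ : \det C \is a GRing.unit)).
rewrite -unitmxE => /(_ uC) /esym; rewrite -[RHS](expr0 (-1)).
by move/(signr_parity two0) => ->.
Qed.

(* Wall's form: if 1 - w = P Q is a rank factorisation then g P = Q^T b for an
   invertible b with b + b^T = b^T Q P, whence det w = det (1 - Q P) = det (- b^-T b). *)
Lemma det_isometry n (g w : 'M[F]_n) : g^T = g -> g \in unitmx ->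
  w^T *m g *m w = g -> \det w = (-1) ^+ \rank (1%:M - w).
Proof.
move=> gT ug isow; set y : 'M_n := 1%:M - w; have defw : w = 1%:M - y by rewrite opprB subrKC.
have E : y^T *m g + g *m y = y^T *m g *m y.
  rewrite /y linearB /= trmx1 !(mulmxBl, mulmxBr) !mul1mx !mulmx1 isow.
  by rewrite opprB addrC.
clearbody y.
have [P [Q [P' [Q' [defy PK QK]]]]] := rank_factorization y.
move: P Q P' Q' defy PK QK; set r := \rank y => P Q P' Q' defy PK QK.
have QtK : Q'^T *m Q^T = 1%:M by rewrite -trmx_mul QK trmx1.
pose b := P^T *m g *m (y - 1%:M) *m Q'.
have gP : g *m P = Q^T *m b.
  have gy : g *m y = Q^T *m (P^T *m g *m (y - 1%:M)).
    rewrite !mulmxA -trmx_mul -defy mulmxBr mulmx1 -E addrAC subrr add0r //.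
  by rewrite /b mulmxA -gy -mulmxA defy -(mulmxA P) QK mulmx1.
have PTg : P^T *m g = b^T *m Q by rewrite -{1}gT -trmx_mul gP trmx_mul trmxK.
have uB : b \in unitmx.
  suff /mulmx1_unit[] : (P' *m invmx g *m Q^T) *m b = 1%:M by [].
  by rewrite -mulmxA -gP mulmxA mulmxKV.
have BB : b^T + b = b^T *m (Q *m P).
  move: E; rewrite defy trmx_mul -(mulmxA Q^T) PTg (mulmxA g) gP.
  move/(congr1 (fun Y => Q'^T *m Y *m Q')).
  rewrite mulmxDr mulmxDl !mulmxA QtK !mul1mx -!mulmxA QK !mulmx1.
  by rewrite !mulmxA.
have -> : \det w = \det (1%:M - Q *m P) by rewrite defw defy det_1subMC.
have uBT : b^T \in unitmx by rewrite unitmx_tr.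
have : b^T *m (1%:M - Q *m P) = (-1) *: b.
  by rewrite mulmxBr mulmx1 -BB opprD addNKr scaleN1r.
move/(congr1 determinant); rewrite det_mulmx detZ det_tr mulrC.
by move/mulIr; apply; rewrite -unitmxE.
Qed.
End FieldMatrices.

(** Write X = P Q with P left invertible: as Y varies, P^T Y P runs through all square matrices of
    size rank X. All of these would be symmetric, which [delta_mx 0 1] refutes in size at least
    2. *)
Lemma rank_le1 n (F : fieldType) (X : 'M[F]_n) :
  (forall Y : 'M[F]_n, X^T *m (Y - Y^T) *m X = 0) -> (\rank X <= 1)%N.
Proof.
have [P [Q [P' [Q' [defX PK QK]]]]] := rank_factorization X.
move: P Q P' Q' defX PK QK; case: (\rank X) => [|[|r]] // P Q P' Q' defX PK QK alt.
have QtK : Q'^T *m Q^T = 1%:M by rewrite -trmx_mul QK trmx1.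
have PtK : P^T *m P'^T = 1%:M by rewrite -trmx_mul PK trmx1.
have PK2 (Z : 'M[F]_r.+2) : P^T *m (P'^T *m Z *m P') *m P = Z.
  by rewrite !mulmxA PtK mul1mx -mulmxA PK mulmx1.
have symZ (Z : 'M[F]_r.+2) : Z - Z^T = 0.
  have PXP (D : 'M[F]_n) : Q'^T *m (X^T *m D *m X) *m Q' = P^T *m D *m P.
    by rewrite defX trmx_mul -!mulmxA QK mulmx1 !mulmxA QtK mul1mx.
  have := PXP (P'^T *m Z *m P' - (P'^T *m Z *m P')^T).
  rewrite alt mulmx0 mul0mx mulmxBr mulmxBl PK2 => ->; congr (_ - _).
  by rewrite !trmx_mul trmxK mulmxA PK2.
move/matrixP: (symZ (delta_mx 0 1)) => /(_ 0 1).
by rewrite trmx_delta !mxE !eqxx /= subr0 => /eqP; rewrite oner_eq0.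
Qed.

(** * Algebra endomorphisms of matrix rings preserve determinants *)

Lemma comaximal_eq0 (S : comNzRingType) (J : Type) (s : seq J) (c x : J -> S) (d : S) :
  (forall j, exists N, x j ^+ N * d = 0) -> \sum_(j <- s) c j * x j = 1 -> d = 0.
Proof.
(* The elements with a power killing [d] form an ideal, the radical of the annihilator of [d]; for
   sums, each binomial term contains a killing power of one summand. *)
move=> ann one; suff [N] : exists N, (\sum_(j <- s) c j * x j) ^+ N * d = 0.
  by rewrite one expr1n mul1r.
apply: (big_ind (fun y => exists N, y ^+ N * d = 0)) => [|a b [N aN] [M bM]|j _].
- by exists 1%N; rewrite mul0r.
- exists (N + M)%N; rewrite exprDn mulr_suml big1 // => i _; rewrite mulrnAl.
  have [le_Mi|lt_iM] := leqP M i.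
    by rewrite -(subnK le_Mi) exprD -!mulrA bM !mulr0 mul0rn.
  have le_N : (N <= N + M - i)%N by rewrite -addnBA ?leq_addr // ltnW.
  by rewrite -(subnK le_N) exprD -!mulrA [b ^+ i * d]mulrC [a ^+ N * _]mulrA aN mul0r mulr0 mul0rn.
by have [N xN] := ann j; exists N; rewrite exprMn -mulrA xN mulr0.
Qed.

(* The images [f i j] of the matrix units satisfy [theta M *m P = P *m M] for the
   matrix [P] with columns [f j 0 v], and such [P] are jointly cancellable because
   the entries of [f 0 0] generate the unit ideal. *)
Lemma det_endomorphism (S : comNzRingType) n (theta : 'M[S]_n.+1 -> 'M[S]_n.+1) M :
  linear theta -> theta 1%:M = 1%:M ->
  {morph theta : X Y / X *m Y} -> \det (theta M) = \det M.
Proof.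
move=> lin th1 thM.
have thD : {morph theta : X Y / X + Y}.
  by move=> X Y; have := lin 1 X Y; rewrite !scale1r.
have th0 : theta 0 = 0 by apply: (addrI (theta 0)); rewrite -thD !addr0.
have thZ c X : theta (c *: X) = c *: theta X.
  by have := lin c X 0; rewrite th0 !addr0.
pose f i j := theta (delta_mx i j).
have fE X : theta X = \sum_i \sum_j X i j *: f i j.
  rewrite {1}[X]matrix_sum_delta (big_morph theta thD th0); apply: eq_bigr => i _.
  by rewrite (big_morph theta thD th0); apply: eq_bigr => j _; rewrite thZ.
have fM i j k l : f i j *m f k l = f i l *+ (j == k).
  rewrite -thM mul_delta_mx_cond; case: (j == k) => //.
pose P b : 'M_n.+1 := \matrix_(i, j) f j 0 i b.
pose Q a : 'M_n.+1 := \matrix_(i, j) f 0 i a j.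
have PM b : theta M *m P b = P b *m M.
  apply/matrixP => i j; rewrite !mxE.
  transitivity ((theta M *m f j 0) i b).
    by rewrite mxE; apply: eq_bigr => l _; rewrite mxE.
  rewrite fE mulmx_suml summxE; apply: eq_bigr => l _; rewrite mulmx_suml summxE.
  rewrite (bigD1 j) //= big1 ?addr0 => [|m /negPf neq].
    by rewrite -scalemxAl fM eqxx !mxE mulrC.
  by rewrite -scalemxAl fM neq mulr0n scaler0 mxE.
have QP a b : Q a *m P b = (f 0 0 a b)%:M.
  apply/matrixP => i j; rewrite !mxE.
  transitivity ((f 0 i *m f j 0) a b).
    by rewrite mxE; apply: eq_bigr => l _; rewrite !mxE.
  by rewrite fM; case: eqP; rewrite ?mulr0n ?mulr1n ?mxE.
have ann a b : f 0 0 a b ^+ n.+1 * (\det (theta M) - \det M) = 0.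
  rewrite -det_scalar -QP det_mulmx mulrBr -!mulrA -[_ * \det (theta M)]mulrC.
  by rewrite -det_mulmx PM det_mulmx subrr.
apply/eqP; rewrite -subr_eq0; apply/eqP.
(* The coefficients are read off the (0, 0) entry of 1 = [theta 1%:M] = sum over i of
   [f i 0 *m f 0 0 *m f 0 i]. *)
apply: (@comaximal_eq0 _ _ (index_enum ('I_n.+1 * ('I_n.+1 * 'I_n.+1))%type)
  (fun p => f p.1 0 0 p.2.1 * f 0 p.1 p.2.2 0) (fun p => f 0 0 p.2.1 p.2.2)).
  by move=> p; exists n.+1.
transitivity ((\sum_i f i 0 *m f 0 0 *m f 0 i) 0 0).
  rewrite summxE [RHS](eq_bigr (fun i =>
    \sum_p f i 0 0 p.1 * f 0 i p.2 0 * f 0 0 p.1 p.2)) ?pair_bigA //=.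
  move=> i _; rewrite -mulmxA mxE [in RHS](eq_bigr (fun p =>
    (f i 0 0 p.1 * f 0 i p.2 0 * f 0 0 p.1 p.2))) //.
  rewrite -(pair_bigA _ (fun a b => f i 0 0 a * f 0 i b 0 * f 0 0 a b)) /=; apply: eq_bigr => a _.
  rewrite mxE mulr_sumr; apply: eq_bigr => b _; rewrite -mulrA; congr (_ * _).
  exact: mulrC.
rewrite (eq_bigr (fun i => f i i)) => [|i _]; last by rewrite !fM !eqxx.
have -> : \sum_i f i i = theta 1%:M.
  by rewrite mx1_sum_delta (big_morph theta thD th0).
by rewrite th1 mxE eqxx.
Qed.

(** * Algebra homomorphisms, involutions and splittings *)

Lemma dual_basis_sum (R : comNzRingType) (A : lmodType R) k (e : 'I_k -> A) f l
    (J : Type) (s : seq J) (r : J -> R) (a : J -> A) : dual_basis e f ->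
  f l (\sum_(x <- s) r x *: a x) = \sum_(x <- s) r x * f l (a x).
Proof.
case=> lin _; have f0 : f l 0 = 0.
  by have := lin l 1 0 0; rewrite scaler0 addr0 mul1r -[LHS]addr0 => /addrI <-.
by elim: s => [|x s IHs]; rewrite ?big_nil // !big_cons lin IHs.
Qed.

(** Shared by splittings and by reductions to residue algebras. *)
Definition alg_hom (R : comNzRingType) (A : algType R) (S : comNzRingType)
    (phi : R -> S) (C : algType S) (psi : A -> C) : Prop :=
  [/\ psi 1 = 1, {morph psi : a b / a + b}, {morph psi : a b / a * b} &
      forall r a, psi (r *: a) = phi r *: psi a].

Section AlgHom.
Variables (R : comNzRingType) (A : algType R) (S : comNzRingType).
Variables (phi : {rmorphism R -> S}) (C : algType S) (psi : A -> C).
Hypothesis psiH : alg_hom phi psi.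

Lemma alg_hom0 : psi 0 = 0.
Proof. by case: psiH => _ D _ _; apply: (addrI (psi 0)); rewrite -D !addr0. Qed.

Lemma alg_homN a : psi (- a) = - psi a.
Proof.
case: psiH => _ D _ _; apply: (addrI (psi a)).
by rewrite -D !subrr alg_hom0.
Qed.

Lemma alg_homB a b : psi (a - b) = psi a - psi b.
Proof. by case: psiH => _ D _ _; rewrite D alg_homN. Qed.

Lemma alg_hom_sum (J : Type) (s : seq J) (r : J -> R) (a : J -> A) :
  psi (\sum_(x <- s) r x *: a x) = \sum_(x <- s) phi (r x) *: psi (a x).
Proof.
case: psiH => _ D _ Z; rewrite (big_morph psi D alg_hom0).
by apply: eq_bigr => x _; rewrite Z.
Qed.

Lemma alg_hom_expand k (e : 'I_k -> A) f (J : Type) (s : seq J) (t : J -> S) a :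
    dual_basis e f ->
  \sum_(x <- s) t x *: psi (a x) =
    \sum_l (\sum_(x <- s) t x * phi (f l (a x))) *: psi (e l).
Proof.
case=> lin ef; transitivity (\sum_(x <- s) \sum_l (t x * phi (f l (a x))) *: psi (e l)).
  apply: eq_bigr => x _; rewrite {1}(ef (a x)) alg_hom_sum scaler_sumr.
  by apply: eq_bigr => l _; rewrite scalerA.
by rewrite exchange_big; apply: eq_bigr => l _; rewrite scaler_suml.
Qed.

End AlgHom.

(** Coordinate vectors of elements of the base change of A to S are fixed by the idempotent matrix
    with entries [phi (f m (e l))]. *)
Lemma coord_expand (R S : comNzRingType) (A : algType R) (phi : {rmorphism R -> S})
    k (e : 'I_k -> A) f (J : Type) (s : seq J) (t : J -> S) a m : dual_basis e f ->
  \sum_l (\sum_(x <- s) t x * phi (f l (a x))) * phi (f m (e l)) =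
    \sum_(x <- s) t x * phi (f m (a x)).
Proof.
move=> ef; under eq_bigr do rewrite mulr_suml.
rewrite exchange_big; apply: eq_bigr => x _.
rewrite {2}(ef.2 (a x)) (dual_basis_sum _ _ _ _ ef) rmorph_sum mulr_sumr.
by apply: eq_bigr => l _; rewrite rmorphM mulrA.
Qed.

Section Involution.
Variables (R : comNzRingType) (A : algType R) (s : A -> A).
Hypothesis sI : involution s.

Lemma involution0 : s 0 = 0.
Proof. by case: sI => sD _ _ _; apply: (addrI (s 0)); rewrite -sD !addr0. Qed.

Lemma involution1 : s 1 = 1.
Proof. by case: sI => _ _ sM sK; rewrite -[LHS]mulr1 -{2}[1]sK -sM mulr1 sK. Qed.

Lemma involutionN a : s (- a) = - s a.
Proof.
case: sI => sD _ _ _; apply: (addrI (s a)).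
by rewrite -sD !subrr involution0.
Qed.

End Involution.

Section Splitting.
Variables (R : comNzRingType) (A : algType R) (S : comNzRingType).
Variables (phi : {rmorphism R -> S}) (n : nat) (psi : A -> 'M[S]_n.+1).
Hypothesis split_psi : splitting phi psi.

Lemma splitting_alg_hom : alg_hom phi psi.
Proof. by case: split_psi. Qed.

(** The last clause is injectivity on the base change of A to S, in a form that lets maps out of the
    matrix ring be defined through arbitrary presentations of a matrix. *)
Lemma splitting_coord : exists k (e : 'I_k -> A) f,
  [/\ dual_basis e f,
      forall M, exists t : 'I_k -> S, M = \sum_j t j *: psi (e j) &
      forall (J1 J2 : Type) (s1 : seq J1) (s2 : seq J2) t1 t2 a1 a2,
        \sum_(x <- s1) t1 x *: psi (a1 x) = \sum_(x <- s2) t2 x *: psi (a2 x) ->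
      forall m, \sum_(x <- s1) t1 x * phi (f m (a1 x)) =
        \sum_(x <- s2) t2 x * phi (f m (a2 x))].
Proof.
have psiH := splitting_alg_hom.
case: split_psi => _ _ _ _ [k [e [f [ef onto ker]]]]; exists k, e, f; split=> //.
move=> J1 J2 s1 s2 t1 t2 a1 a2.
rewrite (alg_hom_expand psiH s1 t1 a1 ef) (alg_hom_expand psiH s2 t2 a2 ef) => /eqP.
rewrite -subr_eq0 -sumrB => /eqP E m.
rewrite -(coord_expand phi s1 t1 a1 m ef) -(coord_expand phi s2 t2 a2 m ef).
apply/eqP; rewrite -subr_eq0 -sumrB; apply/eqP.
rewrite -[RHS](ker (fun l => \sum_(x <- s1) t1 x * phi (f l (a1 x)) -
  \sum_(x <- s2) t2 x * phi (f l (a2 x))) _ m).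
  by apply: eq_bigr => l _; rewrite mulrBl.
by rewrite -[RHS]E; apply: eq_bigr => l _; rewrite scalerBl.
Qed.

(** The homomorphism [psi'] factors through [psi] by an S-algebra endomorphism [theta] of the matrix
    ring, to which [det_endomorphism] applies. *)
Lemma det_splitting_unique (psi' : A -> 'M[S]_n.+1) a :
  alg_hom phi psi' -> \det (psi' a) = \det (psi a).
Proof.
move=> psi'H; have psiH := splitting_alg_hom.
have [k [e [f [ef onto coordP]]]] := splitting_coord.
have [c cE] := boolp.choice onto.
pose theta M := \sum_j c M j *: psi' (e j).
(* [theta] does not depend on the chosen coordinates [c]; linearity and multiplicativity follow by
   presenting sums and products with other families. *)
have thE (J : Type) (s : seq J) t b :
    theta (\sum_(x <- s) t x *: psi (b x)) = \sum_(x <- s) t x *: psi' (b x).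
  set M := \sum_(x <- s) _; rewrite /theta [LHS](alg_hom_expand psi'H _ _ _ ef).
  rewrite [RHS](alg_hom_expand psi'H _ _ _ ef).
  apply: eq_bigr => l _; congr (_ *: _); apply: coordP; exact: (esym (cE M)).
have thpsi b : theta (psi b) = psi' b.
  by have := thE _ [:: tt] (fun=> 1) (fun=> b); rewrite !big_seq1 !scale1r.
rewrite -thpsi; apply: det_endomorphism.
- move=> r X Y; rewrite {1}(cE X) {1}(cE Y) scaler_sumr.
  have := thE _ (map inl (index_enum 'I_k) ++ map inr (index_enum 'I_k))
    (fun x => match x with inl j => r * c X j | inr j => c Y j end)
    (fun x => match x with inl j => e j | inr j => e j end).
  rewrite !big_cat !big_map /= => E.
  rewrite [X in theta (X + _)](eq_bigr (fun j => (r * c X j) *: psi (e j))).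
    by rewrite E scaler_sumr; congr (_ + _); apply: eq_bigr => j _; rewrite scalerA.
  by move=> j _; rewrite scalerA.
- by case: psiH psi'H => one _ _ _ [one' _ _ _]; rewrite -[X in theta X]one thpsi one'.
move=> X Y; rewrite {1}(cE X) {1}(cE Y) mulmx_suml.
have := thE _ (index_enum ('I_k * 'I_k)%type) (fun p => c X p.1 * c Y p.2)
   (fun p => e p.1 * e p.2).
case: psiH psi'H => _ _ M _ [_ _ M' _].
rewrite -(pair_bigA _ (fun i j => (c X i * c Y j) *: psi (e i * e j))).
rewrite -(pair_bigA _ (fun i j => (c X i * c Y j) *: psi' (e i * e j))) /= => E.
transitivity (theta (\sum_i \sum_j (c X i * c Y j) *: psi (e i * e j))).
  congr theta; apply: eq_bigr => i _; rewrite mulmx_sumr; apply: eq_bigr => j _.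
  by rewrite M -scalemxAl -scalemxAr scalerA.
rewrite E /theta mulmx_suml; apply: eq_bigr => i _; rewrite mulmx_sumr; apply: eq_bigr => j _.
by rewrite M' -scalemxAl -scalemxAr scalerA.
Qed.

(** Transposition turns [psi] composed with [s] back into an algebra homomorphism, so its
    determinant is that of [psi]. *)
Lemma det_splitting_involution s a : involution s -> \det (psi (s a)) = \det (psi a).
Proof.
move=> sI; have s1 := involution1 sI; case: sI => sD sZ sM sK.
have [one D M Z] := splitting_alg_hom.
rewrite -(det_tr (psi (s a))).
apply: (@det_splitting_unique (fun b => (psi (s b))^T)); split=> [|b c|b c|r b].
- by rewrite s1 one trmx1.
- by rewrite sD D linearD.
- by rewrite sM M trmx_mul.
- by rewrite sZ Z linearZ.
Qed.

End Splitting.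

(** * Algebras split over a field: ranks and descent *)

Lemma rank_sub_idem (F : fieldType) n (X H : 'M[F]_n) :
  X *m X = X -> H *m H = H -> X *m H = H -> H *m X = H ->
  \rank X = (\rank H + \rank (X - H)%R)%N.
Proof.
(* The row space of [X - H] is the part of the row space of [X] killed by [H]. *)
move=> XX HH XH HX; rewrite -(@mxrank_mul_ker _ _ _ _ X H) XH; congr (_ + _)%N.
apply: eqmx_rank; apply/andP; split; last first.
  rewrite sub_capmx; apply/andP; split; last by apply/sub_kermxP; rewrite mulmxBl XH HH subrr.
  by apply/submxP; exists (X - H); rewrite mulmxBl XX HX.
set V := (X :&: kermx H)%MS.
have /submxP[W VX] : (V <= X)%MS by apply: capmxSl.
have VH : V *m H = 0 by apply/sub_kermxP; apply: capmxSr.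
by apply/submxP; exists V; rewrite mulmxBr VH subr0 VX -mulmxA XX.
Qed.

(** The left kernel of [Z] lies in that of [X], and the rank bound makes the two equal. *)
Lemma left_ker_eq (F : fieldType) m n (X Z H : 'M[F]_n) (V : 'M_(m, n)) :
  X = Z *m H -> (\rank Z <= \rank X)%N -> V *m X = 0 -> V *m Z = 0.
Proof.
move=> XZ rkZ VX; apply/sub_kermxP.
have sub : (kermx Z <= kermx X)%MS by apply/sub_kermxP; rewrite XZ mulmxA mulmx_ker mul0mx.
have := mxrank_leqif_sup sub; rewrite !mxrank_ker => -[le eq].
apply: submx_trans (_ : kermx X <= _)%MS; first by apply/sub_kermxP.
by rewrite -eq eqn_leq le leq_sub2l.
Qed.

Section SplittingField.
Variables (k : fieldType) (B : algType k) (L : fieldType) (phi : {rmorphism k -> L}).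
Variables (n : nat) (psi : B -> 'M[L]_n.+1).
Hypothesis split_psi : splitting phi psi.
Let psiH := splitting_alg_hom split_psi.
Let psiM a b : psi (a * b) = psi a *m psi b.
Proof. by case: psiH. Qed.

Lemma splitting_inj : injective psi.
Proof.
move=> a b eq_ab; have [K [e [f [ef _ coordP]]]] := splitting_coord split_psi.
rewrite (ef.2 a) (ef.2 b); apply: eq_bigr => j _; congr (_ *: _).
have := coordP _ _ [:: tt] [:: tt] (fun=> 1) (fun=> 1) (fun=> a) (fun=> b).
by rewrite !big_seq1 !scale1r => /(_ eq_ab j); rewrite !big_seq1 !mul1r => /fmorph_inj.
Qed.

(* A linear system with coefficients in [k] that is solvable over [L] is solvable over [k]. *)
Lemma splitting_descent (a b w : B) X :
  psi a *m X *m psi b = psi w -> exists x, a * x * b = w.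
Proof.
have [K [e [f [ef onto coordP]]]] := splitting_coord split_psi.
have [t ->] := onto X => E.
pose G := \matrix_(j, l) f l (a * e j * b); pose r := \row_l f l w.
have sub : (r <= G)%MS.
  rewrite -(map_submx phi); apply/submxP; exists (\row_j t j); apply/rowP => m.
  have := coordP _ _ (index_enum 'I_K) [:: tt] t (fun=> 1) (fun j => a * e j * b) (fun=> w).
  rewrite !big_seq1 scale1r -E mulmx_sumr mulmx_suml => /(_ _ m).
  rewrite !big_seq1 mul1r !mxE => <-; first by apply: eq_bigr => j _; rewrite !mxE.
  by apply: eq_bigr => j _; rewrite !psiM -scalemxAr -scalemxAl.
have /submxP[c rG] := sub; exists (\sum_j c 0 j *: e j).
rewrite (ef.2 w) mulr_sumr mulr_suml (ef.2 (\sum_j _)); apply: eq_bigr => l _.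
congr (_ *: _); move/rowP: rG => /(_ l); rewrite !mxE => ->.
under eq_bigr do rewrite -scalerAr -scalerAl.
by rewrite (dual_basis_sum _ _ _ _ ef); apply: eq_bigr => j _; rewrite !mxE.
Qed.

(** Von Neumann regularity descends from the pseudo-inverse over L. *)
Lemma splitting_regular (a : B) : exists x, a * x * a = a.
Proof. by apply: (@splitting_descent _ _ _ (pinvmx (psi a))); rewrite mulmxKpV. Qed.

Lemma splitting_inverse a : psi a \in unitmx -> exists b : B, a * b = 1 /\ b * a = 1.
Proof.
move=> ua; case: psiH => one _ _ _.
have [|b ab] := @splitting_descent a 1 1 (invmx (psi a)).
  by rewrite mulmxV // one mulmx1.
exists b; rewrite mulr1 in ab; split=> //; apply: splitting_inj.
by rewrite psiM one; apply: mulmx1C; have := congr1 psi ab; rewrite psiM one.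
Qed.

(** * Skew elements and isometries for the adjoint involution of a symmetric form *)

Variables (g : 'M[L]_n.+1) (s : B -> B).
Hypotheses (two0 : (2%:R : L) != 0) (gT : g^T = g) (ug : g \in unitmx).
Hypotheses (sE : forall b, psi (s b) = invmx g *m (psi b)^T *m g) (sI : involution s).

Lemma rank_adjoint b : \rank (psi (s b)) = \rank (psi b).
Proof.
rewrite sE mxrankMfree ?row_free_unit // -mxrank_tr trmx_mul trmxK.
by rewrite mxrankMfree // row_free_unit unitmx_tr unitmx_inv.
Qed.

Lemma adjointE b : g *m psi (s b) = (psi b)^T *m g.
Proof. by rewrite sE -mulmxA mulKVmx. Qed.

(** The matrix [g *m psi p] is skew-symmetric of the same rank. *)
Lemma rank_skew_even p : s p = - p -> ~~ odd (\rank (psi p)).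
Proof.
move=> skew; rewrite -(_ : \rank (g *m psi p) = \rank (psi p)).
  apply: rank_alternating_even => //.
  by rewrite trmx_mul gT -adjointE skew (alg_homN psiH) mulmxN.
by rewrite eqmxMfull // row_full_unit.
Qed.

Lemma no_skew_rank_le1 f : (forall b, s f * (b - s b) * f = 0) -> (\rank (psi f) <= 1)%N.
Proof.
move=> noskew; apply: rank_le1 => Y; have [K [e [_ [_ onto _]]]] := splitting_coord split_psi.
have [t Et] := onto (invmx g *m Y).
have -> : Y = \sum_j t j *: (g *m psi (e j)).
  rewrite -[LHS](mulKVmx ug) Et mulmx_sumr.
  by apply: eq_bigr => j _; rewrite scalemxAr.
rewrite linear_sum /= -sumrB mulmx_sumr mulmx_suml big1 // => j _.
rewrite linearZ /= -scalerBr -scalemxAr -scalemxAl trmx_mul gT -adjointE -mulmxBr.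
by rewrite mulmxA -adjointE -(alg_homB psiH) -!mulmxA -!psiM mulrA noskew
  (alg_hom0 psiH) mulmx0 scaler0.
Qed.

Lemma skew_full_rank (f : B) : f * f = f -> ~~ odd (\rank (psi f)) ->
  exists p, [/\ s p = - p, p * f = p & \rank (psi p) = \rank (psi f)].
Proof.
move=> ff even_f; case: sI => sD sZ sM sK.
have s0 := involution0 sI; have sN := involutionN sI.
have skD a b : s (s a * (b - s b) * a) = - (s a * (b - s b) * a).
  by rewrite !sM sK sD sN sK mulrA -mulNr -mulrN opprB.
have rkMr a b : (\rank (psi (a * b)%R) <= \rank (psi b))%N by rewrite psiM mxrankM_maxr.
suff IH m p : s p = - p -> p * f = p -> (\rank (psi f) - \rank (psi p) <= m)%N ->
    exists p, [/\ s p = - p, p * f = p & \rank (psi p) = \rank (psi f)].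
  by apply: (IH (\rank (psi f)) 0); rewrite ?mul0r ?leq_subr // s0 oppr0.
elim: m p => [|m IHm] p skew pf.
  rewrite leqn0 subn_eq0 => le; exists p; split=> //.
  by apply/eqP; rewrite eqn_leq le -{1}pf andbT rkMr.
move=> lem; have [x pxp] := splitting_regular p.
have sfp : s f * p = p by apply: oppr_inj; rewrite -mulrN -skew -sM pf.
(* [h] is an idempotent of f B f with [p * h = p] and the rank of [p]; its complement [f'] in [f] is
   killed by [p]. *)
pose h := f * x * s f * p; pose f' := f - h.
have ph : p * h = p by rewrite /h !mulrA pf -(mulrA (p * x)) sfp.
have hh : h * h = h by rewrite {1}/h -mulrA ph.
have fh : f * h = h by rewrite /h !mulrA ff.
have hf : h * f = h by rewrite /h -!mulrA pf.
have f'f' : f' * f' = f' by rewrite mulrBl !mulrBr ff fh hf hh subrr subr0.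
have f'f : f' * f = f' by rewrite mulrBl ff hf.
have f'h : f' * h = 0 by rewrite mulrBl fh hh subrr.
have pf' : p * f' = 0 by rewrite mulrBr pf ph subrr.
have sf'p : s f' * p = 0 by apply: oppr_inj; rewrite -mulrN -skew -sM pf' s0 oppr0.
have rk_h : \rank (psi h) = \rank (psi p).
  by apply/eqP; rewrite eqn_leq {1}/h rkMr -{1}ph rkMr.
have rk_f : \rank (psi f) = (\rank (psi p) + \rank (psi f'))%N.
  rewrite -rk_h (alg_homB psiH) -rank_sub_idem //;
  by rewrite -[LHS](psiM) ?ff ?hh ?fh ?hf.
clearbody f' h; have [K [e [t [ef _ _]]]] := splitting_coord split_psi.
pose d b := s f' * (b - s b) * f'.
(* As [d] is linear, either it vanishes identically or some generator gives a nonzero skew element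
   to add to [p]. In the first case [f'] has rank at most 1, and by parity rank 0. *)
have [/forallP nod|/forallPn[j dj]] := boolP [forall j, d (e j) == 0].
  have rk_f' : (\rank (psi f') <= 1)%N.
    apply: no_skew_rank_le1 => b.
    have dD : {morph d : a b / a + b}.
      by move=> a c; rewrite /d sD opprD addrACA mulrDr mulrDl.
    have d0 : d 0 = 0 by rewrite /d s0 subrr mulr0 mul0r.
    rewrite -/(d b) (ef.2 b) (big_morph d dD d0) big1 // => j _.
    by rewrite /d sZ -scalerBr -scalerAr -scalerAl [_ * _ * _](eqP (nod j)) scaler0.
  exists p; split=> //; rewrite rk_f; move: even_f rk_f'.
  rewrite rk_f oddD (negPf (rank_skew_even skew)).
  by case: (\rank (psi f')) => [|[]] //; rewrite addn0.
have skew_d : s (d (e j)) = - d (e j) by apply: skD.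
have pdf : (p + d (e j)) * f = p + d (e j) by rewrite mulrDl pf /d -mulrA f'f.
apply: (IHm (p + d (e j))).
- by rewrite sD skew skew_d opprD.
- exact: pdf.
suff lt : (\rank (psi p) < \rank (psi (p + d (e j))))%N.
  rewrite -ltnS; apply: leq_trans lem; apply: ltn_sub2l => //.
  by rewrite (leq_trans lt) // -pdf rkMr.
(* Without growth of the rank, [p] and [p + d (e j)] have the same left kernel. Then [s f'], which
   kills [p], also kills [d (e j)]; but it fixes [d (e j)], which is nonzero. *)
rewrite ltnNge; apply/negP => le.
have pE : p = (p + d (e j)) * h by rewrite mulrDl ph /d -mulrA f'h mulr0 addr0.
have /= := @left_ker_eq _ _ _ (psi p) _ (psi h) (psi (s f')) _ le.
rewrite -!psiM -pE sf'p (alg_hom0 psiH) => /(_ erefl erefl).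
rewrite mulrDr sf'p add0r /d !mulrA -sM f'f' -(alg_hom0 psiH) => /splitting_inj dj0.
by case/eqP: dj.
Qed.

(* The isometry [u] is recovered from [c] as [y * c^-1 * s y - 1]; as opposed to [c],
   all such data lift along reductions. *)
Lemma isometry_factor (u : B) : s u * u = 1 -> \det (psi u) = 1 ->
  exists c d : B, [/\ c * d = 1, d * c = 1,
    c + s c = s (1 + u) * (1 + u) & (1 + u) * d * s (1 + u) = 1 + u].
Proof.
move=> isou detu; case: psiH => one D _ _; case: sI => sD sZ sM sK.
have s1 := involution1 sI.
set y := 1 + u; have [x yxy] := splitting_regular y.
pose f := 1 - x * y.
have yf : y * f = 0 by rewrite mulrBr mulr1 mulrA yxy subrr.
have ff : f * f = f by rewrite {1}/f mulrBl mul1r -mulrA yf mulr0 subr0.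
have even_f : ~~ odd (\rank (psi f)).
  have rk_xy : \rank (psi (x * y)%R) = \rank (psi y).
    apply/eqP; rewrite eqn_leq {1}psiM mxrankM_maxr /=.
    by rewrite -{1}yxy -mulrA psiM mxrankM_maxr.
  have rk1 : (n.+1 = \rank (psi y) + \rank (psi f))%N.
    rewrite -rk_xy /f (alg_homB psiH) -rank_sub_idem -?psiM ?mulr1 ?mul1r //.
      by rewrite one mxrank1.
    by rewrite mulrA -(mulrA x) -(mulrA x) yxy.
  (* [det_isometry] is applied to w = [- psi u], where 1 - w = [psi y] and det w = (-1)^(n+1). *)
  have : odd n.+1 = odd (\rank (psi y)).
    apply: (signr_parity two0).
    have -> : psi y = 1%:M - - psi u by rewrite opprK /y D one.
    rewrite -(det_isometry gT ug); first by rewrite -scaleN1r detZ detu mulr1.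
    have -> : (- psi u)^T = - (psi u)^T by apply/matrixP => i j; rewrite !mxE.
    rewrite !mulNmx mulmxN opprK -adjointE -mulmxA -psiM isou.
    by rewrite one mulmx1.
  by rewrite (congr1 odd rk1) oddD; case: (odd _); case: (odd _).
have [p [skew pf rk_p]] := skew_full_rank ff even_f.
(* Indeed [s y = s u * y], because [s u * u = 1]. *)
have syf : s y * f = 0.
  by rewrite /y sD s1 -isou -{2}[s u]mulr1 -mulrDr addrC -/y -mulrA yf mulr0.
(* A row killed by [s y + p] is killed by [p], as seen after multiplying by [f], hence by [s y].
   Equality of ranks lets [s f] replace [p], and 1 = [s f + s y * s x]. *)
have [|d [cd dc]] := @splitting_inverse (s y + p).
  rewrite -row_free_unit -kermx_eq0; set V := kermx _.
  have V0 : V *m psi (s y + p) = 0 by apply: mulmx_ker.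
  have Vp : V *m psi p = 0.
    have := congr1 (mulmx^~ (psi f)) V0.
    by rewrite /= mul0mx -mulmxA -psiM mulrDl syf pf add0r.
  have Vsy : V *m psi (s y) = 0 by move: V0; rewrite D mulmxDr Vp addr0.
  have sfp : s f * p = p by apply: oppr_inj; rewrite -mulrN -skew -sM pf.
  have Vsf : V *m psi (s f) = 0.
    apply: (left_ker_eq (X := psi p) (H := psi p)) => //; first by rewrite -psiM sfp.
    by rewrite rank_adjoint rk_p.
  rewrite -[V]mulmx1 -[1%:M]one.
  have -> : 1 = s f + s y * s x by rewrite -sM -sD subrK s1.
  by rewrite D psiM mulmxDr Vsf add0r mulmxA Vsy mul0mx.
exists (s y + p), d; split=> //.
  rewrite (sD (s y) p) sK skew addrACA subrr addr0.
  have -> : s y = 1 + s u by rewrite /y sD s1.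
  by rewrite mulrDl mul1r [s u * y]mulrDr mulr1 isou addrC [1 + s u]addrC.
(* Since [(s y + p) * f = p], the inverse [d] sends [p] to [f], which [y] kills. *)
have dp : d * p = f by rewrite -[in LHS]pf -[p * f]add0r -syf -mulrDl mulrA dc mul1r.
have -> : s y = (s y + p) - p by rewrite addrK.
by rewrite mulrBr -!mulrA dc dp mulr1 yf subr0.
Qed.
End SplittingField.

(** * Lifting from the residue algebras of a semilocal ring *)

Lemma maximal_ideal_nonunit (R : comUnitRingType) (r : R) :
  r \isn't a GRing.unit -> exists m : R -> Prop, maximal_ideal m /\ m r.
Proof.
move=> nunit.
pose P (J : R -> Prop) := (forall x, ~ J x) \/ [/\ is_ideal J, J r & ~ J 1].
have [F FP Ftot|A [PA maxA]] := @classical_sets.Zorn_bigcup R P.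
  have [[J0 FJ0 [x0 Jx0]]|none] := boolp.pselect (exists2 J, F J & exists x, J x); last first.
    by left=> x [J FJ Jx]; apply: none; exists J => //; exists x.
  have prop J x : F J -> J x -> [/\ is_ideal J, J r & ~ J 1].
    by move=> /FP[/(_ x)|].
  have [[J00 _ _] J0r _] := prop _ _ FJ0 Jx0.
  right; split=> [||[J FJ J1]]; last by have [_ _] := prop _ _ FJ J1.
    split=> [|x y [J FJ Jx] [K FK Ky]|a x [J FJ Jx]]; first by exists J0.
      have [[_ JD _] _ _] := prop _ _ FJ Jx; have [[_ KD _] _ _] := prop _ _ FK Ky.
      by case: (Ftot _ _ FJ FK) => sub; [exists K | exists J] => //;
        [apply: KD => //; apply: sub | apply: JD => //; apply: sub].
    by have [[_ _ JM] _ _] := prop _ _ FJ Jx; exists J => //; apply: JM.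
  by exists J0.
have [empty|[idA Ar A1]] := PA.
  pose J x := exists a, x = a * r.
  have Jr : J r by exists 1; rewrite mul1r.
  case: (maxA J); first by split=> [x /empty|/(_ r Jr) /empty].
  right; split=> // [|[a ar]].
    split=> [|_ _ [a ->] [b ->]|a _ [b ->]]; first by exists 0; rewrite mul0r.
      by exists (a + b); rewrite mulrDl.
    by exists (a * b); rewrite mulrA.
  by case/negP: nunit; apply/unitrP; exists a; rewrite -ar mulrC -ar.
exists A; split=> //; split=> // J idJ sub.
have [|J1] := boolp.pselect (J 1); first by right.
left; apply: boolp.contrapT => nsub; apply: (maxA J); first by split.
by right; split=> //; apply: sub.
Qed.

Lemma maximal_ideal_ker (R : comNzRingType) (F : fieldType) (pi : {rmorphism R -> F}) :
  (forall c, exists r, pi r = c) -> maximal_ideal (fun r => pi r = 0).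
Proof.
move=> onto; split=> [||J [J0 JD JM] sub].
- split=> [|x y x0 y0|r x x0]; first exact: rmorph0.
    by rewrite rmorphD x0 y0 addr0.
  by rewrite rmorphM x0 mulr0.
- by rewrite rmorph1; apply/eqP; rewrite oner_eq0.
have [[x Jx /eqP x0]|none] := boolp.pselect (exists2 x, J x & pi x <> 0); last first.
  by left=> x Jx; apply: boolp.contrapT => nx; apply: none; exists x.
right; have [y yx] := onto (pi x)^-1.
rewrite -(subrK (y * x) 1); apply: JD; last exact: JM.
by apply: sub; rewrite rmorphB rmorphM rmorph1 yx mulVf // subrr.
Qed.

Section Lifting.
Variables (R : comUnitRingType) (A : algType R) (I : finType) (k : I -> fieldType).
Variables (pi : forall i, {rmorphism R -> k i}) (B : forall i, algType (k i)).
Variable q : forall i, A -> B i.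
Hypothesis maxE : forall m : R -> Prop, maximal_ideal m ->
  exists! i : I, forall r, m r <-> pi i r = 0.
Hypothesis redq : forall i, reduction (pi i) (q i).

Lemma semilocal_unit r : (forall i, pi i r != 0) -> r \is a GRing.unit.
Proof.
move=> nz; apply: boolp.contrapT => /negP /maximal_ideal_nonunit[m [maxm mr]].
by have [i [/(_ r)[/(_ mr)/eqP ir _] _]] := maxE maxm; case/negP: (nz i).
Qed.

(** Chinese remainder theorem: by uniqueness in [maxE] distinct indices have distinct maximal
    kernels, so each other kernel contains an element that is 1 at [i]; these are multiplied. *)
Lemma residue_idempotent i : exists r, pi i r = 1 /\ forall j, j != i -> pi j r = 0.
Proof.
have sep j : exists x, j != i -> pi j x = 0 /\ pi i x = 1.
  have [-> | neq] := eqVneq j i; first by exists 0.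
  have maxj : maximal_ideal (fun r => pi j r = 0).
    by apply: maximal_ideal_ker; case: (redq j).
  have maxi : maximal_ideal (fun r => pi i r = 0).
    by apply: maximal_ideal_ker; case: (redq i).
  have [[x xj /eqP xi]|none] := boolp.pselect (exists2 x, pi j x = 0 & pi i x <> 0).
    have [onto _ _ _] := redq i; have [y yx] := onto (pi i x)^-1.
    by exists (y * x) => _; rewrite !rmorphM xj mulr0 yx mulVf.
  have sub r : pi j r = 0 -> pi i r = 0.
    by move=> rj; apply: boolp.contrapT => ri; apply: none; exists r.
  have [[idi i1 _] [_ _ maxj']] := (maxi, maxj).
  case: (maxj' _ idi sub) => [sub'|//].
  have [l [_ uniq]] := maxE maxj; case/eqP: neq.
  rewrite -(uniq j) // -(uniq i) // => r; split; [exact: sub | exact: sub'].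
have [x xP] := boolp.choice sep.
exists (\prod_(j | j != i) x j); split=> [|l li].
  by rewrite rmorph_prod big1 // => j /xP[].
by rewrite rmorph_prod (bigD1 l) //= (xP l li).1 mul0r.
Qed.

Lemma reduction_alg_hom i : alg_hom (pi i) (q i).
Proof. by case: (redq i) => _ _ []. Qed.

Lemma residue_lift (a : I -> A) : exists b, forall i, q i b = q i (a i).
Proof.
have [r rP] := boolp.choice residue_idempotent.
exists (\sum_i r i *: a i) => i; rewrite (alg_hom_sum (reduction_alg_hom i)).
rewrite (bigD1 i) //= (rP i).1 scale1r big1 ?addr0 // => j ji.
by rewrite (rP j).2 ?scale0r // eq_sym.
Qed.

Hypothesis projA : fg_projective A.

(* Nakayama: with C and P the matrices of x and of the identity in the dual basis,
   C + 1 - P reduces to the identity modulo every maximal ideal. *)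
Lemma near_one_left_inverse x : (forall i, q i x = 1) -> exists z, z * x = 1.
Proof.
move=> qx; have [K [e [f ef]]] := projA.
have f_ker i l a : q i a = 0 -> pi i (f l a) = 0.
  have [_ _ _ /(_ a)[+ _]] := redq i => /[apply] -[s [sP ->]].
  rewrite (dual_basis_sum _ _ _ _ ef) rmorph_sum big_seq big1 // => p /sP p0.
  by rewrite rmorphM p0 mul0r.
pose C := \matrix_(j, l) f l (e j * x); pose P := \matrix_(j, l) f l (e j).
have coordP a : \row_l f l a *m P = \row_l f l a.
  apply/rowP => l; rewrite !mxE {2}(ef.2 a) (dual_basis_sum _ _ _ _ ef).
  by apply: eq_bigr => j _; rewrite !mxE.
have rowC j : row j C = \row_l f l (e j * x) by apply/rowP => l; rewrite !mxE.
have rowP' j : row j P = \row_l f l (e j) by apply/rowP => l; rewrite !mxE.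
have CP : C *m P = C by apply/row_matrixP => j; rewrite row_mul rowC coordP.
have PP : P *m P = P by apply/row_matrixP => j; rewrite row_mul rowP' coordP.
pose M := C + (1%:M - P).
have uM : M \in unitmx.
  rewrite unitmxE; apply: semilocal_unit => i; rewrite -det_map_mx.
  suff -> : map_mx (pi i) M = 1%:M by rewrite det1 oner_eq0.
  have -> : M = 1%:M + (C - P) by rewrite /M addrCA.
  rewrite map_mxD map_mx1; apply/matrixP => j l; rewrite mxE [X in _ + X](_ : _ = 0) ?addr0 //.
  have [one D X _] := reduction_alg_hom i.
  have : f l (e j * x) = f l (e j * x - e j) + f l (e j).
    by have := ef.1 l 1 (e j * x - e j) (e j); rewrite scale1r mul1r subrK.
  rewrite !mxE => ->; rewrite addrK; apply: f_ker.
  by rewrite (alg_homB (reduction_alg_hom i)) X qx mulr1 subrr.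
(* [F] holds the coordinates of 1. Because [M *m P = C], the row [t] solves [t *m C = F], which
   encodes [z * x = 1]. *)
pose F := \row_l f l 1; pose t := F *m invmx M.
have tC : t *m C = F.
  have MP : M *m P = C by rewrite mulmxDl mulmxBl mul1mx CP PP subrr addr0.
  by rewrite -MP mulmxA mulmxKV // coordP.
exists (\sum_j t 0 j *: e j); rewrite mulr_suml [RHS](ef.2 1).
transitivity (\sum_j \sum_l (t 0 j * C j l) *: e l).
  apply: eq_bigr => j _; rewrite -scalerAl {1}(ef.2 (e j * x)) scaler_sumr.
  by apply: eq_bigr => l _; rewrite scalerA [C j l]mxE.
rewrite exchange_big; apply: eq_bigr => l _; rewrite -scaler_suml; congr (_ *: _).
by move/rowP: tC => /(_ l); rewrite mxE [RHS]mxE.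
Qed.


Lemma inverse_lift c : (forall i, exists d, q i c * d = 1 /\ d * q i c = 1) ->
  exists d, c * d = 1 /\ d * c = 1.
Proof.
move=> inv; have qM i a b : q i (a * b) = q i a * q i b.
  by case: (reduction_alg_hom i).
have q1 i : q i 1 = 1 by case: (reduction_alg_hom i).
have lift i : exists a, q i c * q i a = 1 /\ q i a * q i c = 1.
  have [d] := inv i; have [_ /(_ d)[a <-] _ _] := redq i; by exists a.
have [a aP] := boolp.choice lift; have [b bE] := residue_lift a.
have [z zbc] : exists z, z * (b * c) = 1.
  by apply: near_one_left_inverse => i; rewrite qM bE (aP i).2.
exists (z * b); split; last by rewrite -mulrA.
(* As [z * b * c = 1], the product [c * (z * b)] is idempotent; being left invertible it equals
   1. *)
have [w wzb] : exists w, w * (c * (z * b)) = 1.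
  apply: near_one_left_inverse => i; rewrite !qM.
  have qz : q i z = 1 by have := congr1 (q i) zbc; rewrite !qM bE (aP i).2 mulr1 q1.
  by rewrite qz mul1r bE (aP i).1.
have dc : z * b * c = 1 by rewrite -mulrA.
have idem : c * (z * b) * (c * (z * b)) = c * (z * b).
  by rewrite -!mulrA (mulrA z) (mulrA (z * b)) dc mul1r.
by rewrite -[LHS]mul1r -{1}wzb -(mulrA w) idem.
Qed.

End Lifting.

(** * Surjectivity onto the product of the residue groups *)

Unset Implicit Arguments.

Theorem theorem2 (R : comUnitRingType) (A : algType R) (sigma : A -> A)
    (I : finType) (k : I -> fieldType) (pi : forall i, {rmorphism R -> k i})
    (B : forall i, algType (k i)) (q : forall i, A -> B i)
    (tau : forall i, B i -> B i) :
  (2%:R : R) \is a GRing.unit ->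
  (* I indexes Max R (finite: R is semilocal); pi i : R -> R/m_i *)
  (forall m : R -> Prop, maximal_ideal m ->
     exists! i : I, forall r, m r <-> pi i r = 0) ->
  (* B i = A(m_i) with reduction map q i *)
  (forall i, reduction (pi i) (q i)) ->
  (* A is Azumaya *)
  fg_projective A ->
  (forall i, central_simple (B i)) ->
  (* sigma is an orthogonal involution; tau i = sigma(m_i) *)
  involution sigma ->
  (forall i a, tau i (q i a) = q i (sigma a)) ->
  (forall i, orthogonal_field (tau i)) ->
  (* surjectivity of SO(A,sigma) -> prod_i SO(A(m_i), sigma(m_i)) *)
  forall u : forall i, B i, (forall i, in_SO (tau i) (u i)) ->
  exists v : A, in_SO sigma v /\ forall i, q i v = u i.
Proof.
move=> two maxE redq projA _ sI tauE orth u uSO.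
have [sD sZ sM sK] := sI.
have qH i := reduction_alg_hom redq i.
have tauI i : involution (tau i).
  have [one D M Z] := qH i; have [onto ontoq _ _] := redq i.
  split=> [a b|c a|a b|a].
  - by have [[a' <-] [b' <-]] := (ontoq a, ontoq b); rewrite -D !tauE sD D.
  - by have [[c' <-] [a' <-]] := (onto c, ontoq a); rewrite -Z !tauE sZ Z.
  - by have [[a' <-] [b' <-]] := (ontoq a, ontoq b); rewrite -M !tauE sM M.
  - by have [a' <-] := ontoq a; rewrite !tauE sK.
have qu i : exists a, q i a = u i by have [_ /(_ (u i))] := redq i.
have [au auE] := boolp.choice qu; have [y0 y0E] := residue_lift maxE redq au.
pose y := 1 + y0; pose h : R := 2%:R^-1.
have qy i : q i y = 1 + u i by have [one D _ _] := qH i; rewrite /y D one y0E auE.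
clearbody y; have qc i : exists a, exists d, [/\ q i a * d = 1, d * q i a = 1,
    q i a + tau i (q i a) = tau i (q i y) * q i y & q i y * d * tau i (q i y) = q i y].
  have [L [phi [n [psi [g [split_psi gT ug tE]]]]]] := orth i.
  have [isou nrdu] := uSO i.
  have two0 : (2%:R : L) != 0.
    have := rmorph_unit phi (rmorph_unit (pi i) two).
    by rewrite !rmorph_nat unitfE.
  have [c [d]] := isometry_factor split_psi two0 gT ug tE (tauI i) isou (nrdu _ _ _ _ split_psi).
  by rewrite -qy; have [_ /(_ c)[a <-] _ _] := redq i; exists a, d.
have [ac acE] := boolp.choice qc; have [c0 c0E] := residue_lift maxE redq ac.
(* The symmetric part of [c] is forced to be half of [sigma y * y], and the skew part is taken from
   [c0]. The residues of [c0] satisfy the relation already, so [c] reduces to them too. *)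
pose c := h *: (sigma y * y + (c0 - sigma c0)).
have hh a : h *: (a + a) = a :> A.
  by rewrite -mulr2n -scaler_nat scalerA mulVr // scale1r.
have sN := involutionN sI.
have cc : c + sigma c = sigma y * y.
  rewrite /c sZ -scalerDr !sD sN sM !sK addrACA.
  by rewrite -[sigma c0 - c0]opprB subrr addr0 hh.
have qcE i : q i c = q i (ac i).
  have [_ D M Z] := qH i; have [d [_ _ cE _]] := acE i.
  rewrite /c Z D (alg_homB (qH i)) M c0E -!tauE c0E -cE addrACA subrr addr0.
  rewrite -mulr2n -scaler_nat scalerA -(rmorph_nat (pi i)) -rmorphM mulVr //.
  by rewrite rmorph1 scale1r.
have [|d [cd dc]] := inverse_lift maxE redq projA (c := c).
  by move=> i; have [d [cd dc _ _]] := acE i; exists d; rewrite qcE.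
have s1 := involution1 sI.
exists (y * d * sigma y - 1); split; first split.
(* This is the relation for [c] multiplied by [sigma d] and [d]; multiplying further by [y] and
   [sigma y] shows that the element is an isometry. *)
- have sdd : sigma d * (sigma y * y) * d = sigma d + d.
    rewrite -cc mulrDr mulrDl -(mulrA _ c) cd mulr1 -sM cd s1 mul1r //.
  have sv : sigma (y * d * sigma y - 1) = y * sigma d * sigma y - 1.
    by rewrite sD sN s1 !sM sK mulrA.
  have := congr1 (fun a => y * a * sigma y) sdd.
  rewrite mulrDr mulrDl !mulrA sv mulrBl mul1r mulrBr mulr1 !mulrA => ->.
  by rewrite [X in X - _]addrAC subrr add0r opprB addrC subrK.
- move=> S phi n psi split_psi.
  have [one D M Z] := splitting_alg_hom split_psi.
  have psiH := splitting_alg_hom split_psi.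
  rewrite (alg_homB psiH) -mulrA M one.
  (* Swapping the factors turns the determinant into that of [d * sigma y * y - 1], which is
     [d * sigma c]; and [sigma c] has the determinant of [c], the inverse of [d]. *)
  have -> : psi y * psi (d * sigma y) - 1 = - (1%:M - psi y *m psi (d * sigma y)).
    exact: esym (opprB _ _).
  rewrite -scaleN1r detZ det_1subMC -detZ scaleN1r opprB.
  have -> : psi (d * sigma y) *m psi y - 1%:M = psi (d * sigma c).
    transitivity (psi (d * sigma y * y) - psi 1); first by rewrite (M _ y) one.
    by rewrite -(alg_homB psiH) -mulrA -cc mulrDr dc addrC addKr.
  rewrite M detM (det_splitting_involution split_psi _ sI) -detM -M dc one.
  exact: det1.
- move=> i; have [_ D M Z] := qH i; have [d' [cd' dc' _ yE]] := acE i.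
  have qd : q i d = d'.
    rewrite -[LHS]mul1r -dc' -qcE -mulrA -M cd.
    by have [-> _ _ _] := qH i; rewrite mulr1.
  rewrite (alg_homB (qH i)) !M qd -tauE yE qy.
  by have [-> _ _ _] := qH i; rewrite addrC addKr.
Qed.
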